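(* Let $I\subset\mathbb{R}$ be an interval and let $M,N\colon I^2\to I$ be means with $M(x,y)\le N(x,y)$ for all $x,y\in I$, satisfying $|M(x,y)-N(x,y)|<|x-y|$ for all $x,y\in I$ with $x\neq y$. Let $\mathscr{T}\colon I^2\to I$ be the transfinite invariant mean of the pair $(M,N)$. Then either $\mathscr{T}$ is the unique continuous $(M,N)$-invariant mean, or there are no continuous $(M,N)$-invariant means.
   Context: A mean on an interval $I$ is a function $M\colon I^2\to I$ with $\min(x,y)\le M(x,y)\le\max(x,y)$ for all $x,y\in I$ (no continuity is assumed). For means $M,N$ on $I$, a mean $K\colon I^2\to I$ is called $(M,N)$-invariant if $K(x,y)=K(M(x,y),N(x,y))$ for all $x,y\in I$. Transfinite invariant mean: let $M\le N$ be means on $I$ with $|M(x,y)-N(x,y)|<|x-y|$ whenever $x\ne y$. For $x,y\in I$ define transfinite sequences $(x_\alpha)$, $(y_\alpha)$ indexed by ordinals by $x_0=x$, $y_0=y$; $x_{\alpha+1}=M(x_\alpha,y_\alpha)$, $y_{\alpha+1}=N(x_\alpha,y_\alpha)$ for every ordinal $\alpha$; and $x_\alpha=\lim_{\beta\nearrow\alpha}x_\beta$, $y_\alpha=\lim_{\beta\nearrow\alpha}y_\beta$ for every limit ordinal $\alpha$. (These limits exist since, for indices $\ge 1$, $(x_\alpha)$ is nondecreasing, $(y_\alpha)$ is nonincreasing, and both are bounded between $\min(x,y)$ and $\max(x,y)$.) With $\omega_1$ the first uncountable ordinal, one has $x_{\omega_1}=y_{\omega_1}$, and the transfinite invariant mean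 is defined by $\mathscr{T}(x,y):=x_{\omega_1}=y_{\omega_1}$. *)

(* Defs.v *)
From HB Require Import structures.
From mathcomp Require Import all_boot all_order all_algebra.
From mathcomp Require Import all_classical all_reals all_analysis.
From mathcomp Require wochoice.

Set Implicit Arguments.
Unset Strict Implicit.
Unset Printing Implicit Defensive.

Import Order.TTheory GRing.Theory Num.Theory.
Import numFieldNormedType.Exports.

Local Open Scope classical_set_scope.
Local Open Scope ring_scope.

(* Ordinals are represented by the elements of a well-ordered type W (an
   orderType whose strict order is well founded): a : W stands for the order
   type of its set of predecessors, so that the least element is the ordinal 0
   and b is the successor of a when [is_succ a b]. *)
Section Ordinals.
Context {d : Order.disp_t} {W : orderType d}.
Implicit Types a b c : W.

Definition wellfounded_lt (d' : Order.disp_t) (V : orderType d') : Prop :=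
  well_founded (fun a b : V => (a < b)%O).

Definition predecessors a : set W := [set b | (b < a)%O].

Definition is_zero a : Prop := forall b, (a <= b)%O.

Definition is_succ a b : Prop :=
  (a < b)%O /\ forall c, (a < c)%O -> (b <= c)%O.

Definition is_limit b : Prop := ~ is_zero b /\ ~ exists a, is_succ a b.

Definition is_omega1 a : Prop :=
  ~ countable (predecessors a) /\
  forall b, (b < a)%O -> countable (predecessors b).

(* The filter of the limits with b increasing to a. *)
Definition below a : set_system W :=
  filter_from (predecessors a) (fun c => [set b | (c <= b < a)%O]).

End Ordinals.

Section Means.
Context {R : realType}.
Implicit Types (I : set R) (M N K L : R -> R -> R).

(* Functions I^2 -> I are represented by total functions on R^2, of which only
   the values on I^2 are constrained. *)
Definition is_mean I M : Prop :=
  forall x y, I x -> I y ->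
    I (M x y) /\ Num.min x y <= M x y <= Num.max x y.

Definition invariant I M N K : Prop :=
  forall x y, I x -> I y -> K x y = K (M x y) (N x y).

Definition continuous_on_square I K : Prop :=
  {within I `*` I, continuous (fun z : R * R => K z.1 z.2)}.

Definition continuous_invariant_mean I M N K : Prop :=
  [/\ is_mean I K, invariant I M N K & continuous_on_square I K].

Definition eq_on_square I K L : Prop :=
  forall x y, I x -> I y -> K x y = L x y.

End Means.

Section TransfiniteMean.
Context {R : realType} {d : Order.disp_t} {W : orderType d}.
Variables (wfW : wellfounded_lt W) (M N : R -> R -> R).

(* The pair (x_a, y_a) computed from the pairs (x_b, y_b), b < a; the map
   [prev] extends [rec] to W, with irrelevant values outside b < a. *)
Definition transfinite_step (x y : R) (a : W)
    (rec : forall b, (b < a)%O -> R * R) : R * R :=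
  let prev b : R * R :=
    if pselect (b < a)%O is left h then rec b h else (0, 0) in
  if pselect (is_zero a) then (x, y)
  else if pselect (exists p, is_succ p a) is left h then
    let p := projT1 (cid h) in
    (M (prev p).1 (prev p).2, N (prev p).1 (prev p).2)
  else (lim ((fun b => (prev b).1) @ below a),
        lim ((fun b => (prev b).2) @ below a)).

Definition transfinite_seq (x y : R) : W -> R * R :=
  Fix wfW (fun _ => (R * R)%type) (@transfinite_step x y).

(* With w1 the first uncountable ordinal, this is x_{w1}; under the hypotheses
   of the theorem, x_{w1} = y_{w1}. *)
Definition transfinite_mean (w1 : W) (x y : R) : R :=
  (transfinite_seq x y w1).1.

Lemma transfinite_seqE x y a :
  transfinite_seq x y a =
  transfinite_step x y (fun b (_ : (b < a)%O) => transfinite_seq x y b).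
Proof.
apply: (Fix_eq wfW (fun _ => (R * R)%type) (@transfinite_step x y)).
move=> c f g fg; suff -> : f = g by [].
by apply: functional_extensionality_dep => b;
   apply: functional_extensionality_dep => h.
Qed.

Lemma transfinite_seq_zero x y a :
  is_zero a -> transfinite_seq x y a = (x, y).
Proof.
by move=> a0; rewrite transfinite_seqE /transfinite_step; case: (pselect (is_zero a)).
Qed.

Lemma transfinite_seq_succ x y a b : is_succ a b ->
  transfinite_seq x y b =
  (M (transfinite_seq x y a).1 (transfinite_seq x y a).2,
   N (transfinite_seq x y a).1 (transfinite_seq x y a).2).
Proof.
move=> ab; rewrite transfinite_seqE /transfinite_step.
case: (pselect (is_zero b)) => [b0|nb0] /=; first by have := ab.1; rewrite ltNge b0.
case: (pselect (exists p, is_succ p b)) => [h|]; last by case; exists a.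
case: (cid h) => p pb /=.
have -> : p = a.
  apply/eqP; rewrite eq_le; apply/andP; split; rewrite leNgt; apply/negP.
    by move=> /ab.2; rewrite leNgt pb.1.
  by move=> /pb.2; rewrite leNgt ab.1.
by case: pselect => // /(_ ab.1).
Qed.

Lemma transfinite_seq_limit x y a : is_limit a ->
  transfinite_seq x y a =
  (lim ((fun b => (transfinite_seq x y b).1) @ below a),
   lim ((fun b => (transfinite_seq x y b).2) @ below a)).
Proof.
move=> [a0 aS]; rewrite transfinite_seqE /transfinite_step.
case: (pselect (is_zero a)) => //= na0.
case: (pselect (exists p, is_succ p a)) => //= naS.
have eqf (f g : W -> R) : (forall b, (b < a)%O -> f b = g b) ->
    f @ below a = g @ below a.
  move=> fg; apply/seteqP; split=> A [c ca cA]; exists c => // b /= cb;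
    have /andP[_ ba] := cb; have := cA b cb; by rewrite /= fg.
by congr (lim _, lim _); apply: eqf => b ba; case: (pselect (b < a)%O).
Qed.

End TransfiniteMean.

Lemma uncountable_set_nat : ~ countable [set: set nat].
Proof.
move=> /countable_injP[f finj].
pose D : set nat := [set n | exists2 A : set nat, f A = n & ~ A n].
have DfD : D (f D) <-> ~ D (f D).
  split=> [[A fA nA]|nD]; last by exists D.
  by rewrite -{1}(finj A D) ?inE ?fA.
have nD : ~ D (f D) by move=> h; exact: (DfD.1 h h).
exact/nD/DfD.2.
Qed.

Lemma wellfounded_ltP (d : Order.disp_t) (W : orderType d) :
  (forall A : set W, A !=set0 -> exists2 a, A a & forall b, A b -> (a <= b)%O) ->
  wellfounded_lt W.
Proof.
move=> minW a; apply: contrapT => na.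
have [|b nb bmin] := minW [set c | ~ Acc (fun a b : W => (a < b)%O) c].
  by exists a.
apply: nb; constructor=> c cb; apply: contrapT => /bmin.
by rewrite leNgt cb.
Qed.

Section WithTop.
Variables (S : choiceType) (le : rel S).
Hypothesis wo : wochoice.well_order le.

Let leo (x y : option S) : bool :=
  match x, y with
  | _, None => true
  | None, Some _ => false
  | Some a, Some b => le a b
  end.

Let lto (x y : option S) : bool := (y != x) && leo x y.

Let wole : wochoice.wo_chain le predT.
Proof. by apply: wochoice.withinW. Qed.

Let leoT : total leo.
Proof.
by move=> [a|] [b|] //=; exact: (wochoice.wo_chainW wole).
Qed.

Let leo_anti : antisymmetric leo.
Proof.
move=> [a|] [b|] //= ab; congr Some.
by apply: (wochoice.wo_chain_antisymmetric wole).
Qed.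

Let leo_min (A : set (option S)) : A !=set0 ->
  exists2 a, A a & forall b, A b -> leo a b.
Proof.
move=> [a Aa].
have [[s As]|nA] := pselect (exists s, A (Some s)).
  have [|m [[mA mmin] _]] := wo (A := [pred s | `[< A (Some s) >]]).
    by exists s; apply/asboolP.
  exists (Some m); first exact/asboolP.
  by move=> [b|] //= Ab; apply: mmin; apply/asboolP.
case: a Aa => [s|] Aa; first by case: nA; exists s.
by exists None => // -[s|] // As; case: nA; exists s.
Qed.

Let leo_trans : transitive leo.
Proof.
move=> y x z xy yz.
have [|m Am mmin] := leo_min (A := [set x; y; z]); first by exists x; left; left.
have mx := mmin x (or_introl (or_introl erefl)).
have my := mmin y (or_introl (or_intror erefl)).
have mz := mmin z (or_intror erefl).
case: Am => [[|]|] /= e; subst m => //.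
  by rewrite (leo_anti (x := x) (y := y)) ?xy.
by rewrite -(leo_anti (x := y) (y := z)) ?yz.
Qed.

Let order_mixin :=
  @Order.isOrder.Build Order.default_display (option S) leo lto
   (fun x y => if lto x y then x else y) (fun x y => if lto x y then y else x)
   (fun _ _ => erefl) (fun _ _ => erefl) (fun _ _ => erefl)
   leo_anti leo_trans leoT.

Let W : orderType Order.default_display := HB.pack (option S) order_mixin.

Lemma well_order_with_top : exists (V : orderType Order.default_display)
    (i : S -> V) (t : V),
  [/\ wellfounded_lt V, injective i & forall s, (i s < t)%O].
Proof.
exists W, Some, None; split.
- by apply: wellfounded_ltP => A /leo_min.
- by move=> ? ? [].
- by [].
Qed.

End WithTop.

(* The hypotheses [wellfounded_lt W] and [is_omega1 w1] can be satisfied. *)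
Lemma omega1_exists :
  exists (d : Order.disp_t) (W : orderType d) (w1 : W),
    wellfounded_lt W /\ is_omega1 w1.
Proof.
have [le wo] := wochoice.well_ordering_principle (set nat).
have [W [i [t [wfW iinj it]]]] := well_order_with_top wo.
exists Order.default_display, W.
have unct : ~ countable (predecessors t).
  move=> /countable_injP[f finj]; apply: uncountable_set_nat.
  apply/countable_injP; exists (f \o i) => x y _ _ /= fxy.
  by apply/iinj/finj => //; rewrite inE; exact: it.
move: t {it} unct; apply: (well_founded_ind wfW) => t IH unct.
have [[s st us]|h] :=
  pselect (exists2 s, (s < t)%O & ~ countable (predecessors s)).
  exact: IH s st us.
exists t; split=> //; split=> // b bt; apply: contrapT => ub.
by apply: h; exists b.
Qed.

(* Main.v *)
Require Import Defs.
From mathcomp Require Import all_boot all_order all_algebra.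
From mathcomp Require Import all_classical all_reals all_analysis.

Set Implicit Arguments.
Unset Strict Implicit.

Import Order.TTheory GRing.Theory Num.Theory.
Import numFieldNormedType.Exports.

Local Open Scope classical_set_scope.
Local Open Scope ring_scope.

(** The idea is that a continuous invariant mean [K] is constant along every
    transfinite orbit [(x_a, y_a)]: invariance carries the value through
    successor steps and continuity carries it through limit steps
    ([invariant_transfinite_seq]). The orbit meets the diagonal at the first
    uncountable ordinal ([transfinite_seq_omega1]), where [K (t, t) = t]
    because [K] is a mean; hence [K] agrees with the transfinite mean on the
    square. So as soon as one continuous invariant mean exists, the transfinite
    mean is one, and it is the only one.

    The orbit reaches the diagonal because the intervals with endpoints [x_a],
    [y_a] are nested ([transfinite_seq_nested]) and, off the diagonal, their
    length strictly decreases. A strictly decreasing real function on an ordinal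
    leaves disjoint gaps between consecutive values, each containing a rational
    number, so that ordinal is countable
    ([countable_predecessors_decreasing]). *)

(** * Well-ordered types and limits from below *)

Section WellOrder.
Context {d : Order.disp_t} {W : orderType d}.
Hypothesis wfW : wellfounded_lt W.
Implicit Types a b c : W.

Lemma wellfounded_min (A : set W) : A !=set0 ->
  exists2 a, A a & forall b, A b -> (a <= b)%O.
Proof.
case=> a0; apply: (well_founded_ind wfW
  (fun a => A a -> exists2 a', A a' & forall b, A b -> (a' <= b)%O)).
move=> a IH Aa.
have [[b ba Ab]|h] := pselect (exists2 b, (b < a)%O & A b).
  exact: IH ba Ab.
exists a => // b Ab; rewrite leNgt; apply/negP => ba.
by apply: h; exists b.
Qed.

Lemma zero_exists (a : W) : exists z : W, is_zero z.
Proof.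
have [|z _ zmin] := wellfounded_min (A := setT); first by exists a.
by exists z => b; exact: zmin.
Qed.

Lemma succ_exists b c : (b < c)%O -> exists2 s, is_succ b s & (s <= c)%O.
Proof.
move=> bc; have [|s bs smin] := wellfounded_min (A := [set s | (b < s)%O]).
  by exists c.
by exists s; [split | exact: smin].
Qed.

(** Limits from below are studied from a nonzero index on, where orbits are
    monotone. *)
Lemma limit_nonzero_below a : is_limit a -> exists2 b, (b < a)%O & ~ is_zero b.
Proof.
move=> [na0 nS]; have [z z0] := zero_exists a.
have za : (z < a)%O.
  rewrite lt_neqAle z0 andbT; apply/eqP => za.
  by apply: na0; rewrite -za.
have [b zb ba] := succ_exists za.
exists b; last by move=> /(_ z); rewrite leNgt zb.1.
rewrite lt_neqAle ba andbT; apply/eqP => eba; subst b.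
by apply: nS; exists z.
Qed.

Lemma below_filter a : ~ is_zero a -> ProperFilter (below a).
Proof.
move=> a0; apply: filter_from_proper; last first.
  by move=> c ca; exists c; rewrite /= lexx.
apply: filter_from_filter.
  apply: contrapT => h; apply: a0 => b; rewrite leNgt; apply/negP => ba.
  by apply: h; exists b.
move=> i j ia ja; exists (Order.max i j).
  by rewrite /predecessors /= gt_max ia ja.
by move=> b /=; rewrite ge_max -andbA => /and3P[-> -> ->].
Qed.

Lemma near_below a b (P : set W) : (b < a)%O ->
  (forall c, (b <= c)%O -> (c < a)%O -> P c) -> \forall c \near below a, P c.
Proof. by move=> ba bP; exists b => // c /andP[bc ca]; exact: bP. Qed.

Lemma cvg_below_nondecreasing {R : realType} (u : W -> R) a b m : (b < a)%O ->
  (forall c e, (b <= c)%O -> (c <= e)%O -> (e < a)%O -> u c <= u e) ->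
  (forall c, (b <= c)%O -> (c < a)%O -> u c <= m) ->
  cvg (u @ below a).
Proof.
move=> ba u_mono u_ub.
have a0 : ~ is_zero a by move=> /(_ b); rewrite leNgt ba.
have FF := below_filter a0.
pose S := [set u c | c in [set c | (b <= c < a)%O]].
have supS : has_sup S.
  split; first by exists (u b); exists b; rewrite /= ?lexx.
  by exists m => _ [c /andP[bc ca] <-]; exact: u_ub.
apply/cvg_ex; exists (sup S); apply/cvgrPdist_le => e e0.
have [_ [c /andP[bc ca] <-] uc] := sup_adherent e0 supS.
apply: (@near_below _ c) => // k ck ka.
have uk : u k <= sup S.
  apply: ub_le_sup; first exact: supS.2.
  by exists k; rewrite /= ?ka ?(le_trans bc).
rewrite ger0_norm ?subr_ge0// lerBlDl -lerBlDr (le_trans (ltW uc))//.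
exact: u_mono.
Qed.

(** The rational chosen in the gap between the values at [b] and at the
    successor of [b] determines [b]: gaps at distinct places are disjoint. *)
Lemma countable_predecessors_decreasing {R : realType} (f : W -> R) a :
  (forall b c, (b < c)%O -> (c <= a)%O -> f c < f b) ->
  countable (predecessors a).
Proof.
move=> f_decr.
have gap b : exists q : rat, (b < a)%O ->
    ratr q < f b /\ forall c, (b < c)%O -> (c <= a)%O -> f c < ratr q.
  have [ba|nba] := pselect (b < a)%O; last by exists 0.
  have [s bs sa] := succ_exists ba.
  have [q] := rat_in_itvoo (f_decr _ _ bs.1 sa).
  rewrite in_itv /= => /andP[sq qb]; exists q => _; split=> // c bc ca.
  have := bs.2 _ bc; rewrite le_eqVlt => /predU1P[<- //|sc].
  exact: lt_trans (f_decr _ _ sc ca) sq.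
have [q qP] := choice gap.
have q_neq b c : (b < c)%O -> (c < a)%O -> q b <> q c.
  move=> bc ca qbc.
  have := (qP b (lt_trans bc ca)).2 c bc (ltW ca).
  by rewrite qbc ltNge (ltW (qP c ca).1).
apply/countable_injP; exists (fun b => choice.pickle (q b)) => b c.
rewrite !inE => ba ca /(pcan_inj choice.pickleK) qbc.
by case: (ltgtP b c) => // [bc|cb]; [case: (q_neq b c) | case: (q_neq c b)].
Qed.

End WellOrder.

(** * Transfinite orbits *)

Section Orbit.
Context {R : realType} {d : Order.disp_t} {W : orderType d}.
Variables (wfW : wellfounded_lt W) (I : set R) (M N : R -> R -> R).
Hypotheses (hI : is_interval I) (hM : is_mean I M) (hN : is_mean I N)
  (hMN : forall x y, I x -> I y -> M x y <= N x y).
Variables (x y : R) (Ix : I x) (Iy : I y).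

Local Notation orbit := (transfinite_seq wfW M N x y).
Local Notation lo a := (Num.min (orbit a).1 (orbit a).2).
Local Notation hi a := (Num.max (orbit a).1 (orbit a).2).

(** The order [x_a <= y_a] may fail at index 0; minima and maxima make the
    interval spanned by [x] and [y] the first of the nested intervals. *)
Definition nested_at (a : W) : Prop :=
  [/\ I (orbit a).1, I (orbit a).2,
      ~ is_zero a -> (orbit a).1 <= (orbit a).2 &
      forall b, (b <= a)%O ->
        lo b <= (orbit a).1 <= hi b /\ lo b <= (orbit a).2 <= hi b].

Lemma between_le a b (t : R) : nested_at b -> lo b <= t <= hi b ->
  (a <= b)%O -> lo a <= t <= hi a.
Proof.
move=> [_ _ _ bP] /andP[bt tb] /bP[/andP[l1 u1] /andP[l2 u2]].
by rewrite (le_trans _ bt) ?le_min ?l1//= (le_trans tb)// ge_max u1.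
Qed.

Lemma nested_zero a : is_zero a -> nested_at a.
Proof.
move=> a0; have oa : orbit a = (x, y) by exact: transfinite_seq_zero.
split; rewrite ?oa//= => b ba.
have -> : b = a by apply/eqP; rewrite eq_le ba a0.
by rewrite oa /= !ge_min !le_max !lexx !orbT.
Qed.

Lemma nested_succ p a : is_succ p a -> nested_at p -> nested_at a.
Proof.
move=> pa Pp; have [I1 I2 _ _] := Pp.
have oa := transfinite_seq_succ wfW M N x y pa.
have [IM Mb] := hM I1 I2; have [IN Nb] := hN I1 I2.
have le12 : (orbit a).1 <= (orbit a).2 by rewrite oa hMN.
split=> // [||b]; rewrite ?oa//= => ba.
have [eba|nba] := eqVneq b a.
  by rewrite eba !min_l ?max_r// oa /= !lexx hMN.
have bp : (b <= p)%O.
  by rewrite leNgt; apply/negP => /pa.2; rewrite leNgt lt_neqAle nba ba.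
by split; exact: (between_le Pp).
Qed.

(** From index 1 on, [x_b] and [y_b] are the left and right endpoints of their
    interval, so nestedness below [a] makes them monotone. *)
Lemma nested_cvg a : is_limit a -> (forall b, (b < a)%O -> nested_at b) ->
  orbit b @[b --> below a] --> orbit a /\
  cvg ((fun b => (orbit b).1) @ below a) /\
  cvg ((fun b => (orbit b).2) @ below a).
Proof.
move=> la Pa; have [b0 b0a nz] := limit_nonzero_below wfW la.
have FF := below_filter la.1.
have ordered c : (b0 <= c)%O -> (c < a)%O ->
    lo c = (orbit c).1 /\ hi c = (orbit c).2.
  move=> bc ca; have [_ _ le12 _] := Pa c ca.
  have {}le12 : (orbit c).1 <= (orbit c).2.
    by apply: le12 => c0; apply: nz => k; exact: le_trans bc (c0 k).
  by rewrite min_l ?max_r.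
have cvg1 : cvg ((fun b => (orbit b).1) @ below a).
  apply: (@cvg_below_nondecreasing _ _ _ _ _ b0 (hi b0)) => //.
    move=> c e bc ce ea; have [_ _ _ /(_ c ce)[/andP[+ _] _]] := Pa e ea.
    by rewrite (ordered c bc (le_lt_trans ce ea)).1.
  by move=> c bc ca; have [_ _ _ /(_ b0 bc)[/andP[]]] := Pa c ca.
have cvg2 : cvg ((fun b => (orbit b).2) @ below a).
  have cvgN2 : cvg ((fun b => - (orbit b).2) @ below a).
    apply: (@cvg_below_nondecreasing _ _ _ _ _ b0 (- lo b0)) => //.
      move=> c e bc ce ea; have [_ _ _ /(_ c ce)[_ /andP[_ +]]] := Pa e ea.
      by rewrite (ordered c bc (le_lt_trans ce ea)).2 lerN2.
    move=> c bc ca; have [_ _ _ /(_ b0 bc)[_ /andP[+ _]]] := Pa c ca.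
    by rewrite lerN2.
  rewrite (_ : (fun b => (orbit b).2) = - (fun b => - (orbit b).2)).
    exact: is_cvgN.
  by apply/funext => b; rewrite fctE opprK.
split=> //; rewrite [X in _ --> X](transfinite_seq_limit wfW M N x y la).
rewrite (_ : orbit = fun b => ((orbit b).1, (orbit b).2)).
  exact: cvg_pair cvg1 cvg2.
by apply/funext => b; case: (orbit b).
Qed.

Lemma nested_limit a : is_limit a -> (forall b, (b < a)%O -> nested_at b) ->
  nested_at a.
Proof.
move=> la Pa; have [_ [cvg1 cvg2]] := nested_cvg la Pa.
have [b0 b0a nz] := limit_nonzero_below wfW la.
have FF := below_filter la.1.
have oa := transfinite_seq_limit wfW M N x y la.
have le12 : (orbit a).1 <= (orbit a).2.
  rewrite oa /= -subr_ge0 -limB//; apply: limr_ge; first exact: is_cvgB.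
  apply: (near_below b0a) => c bc ca; have [_ _ le12 _] := Pa c ca.
  rewrite fctE subr_ge0; apply: le12 => c0.
  by apply: nz => k; exact: le_trans bc (c0 k).
have bounds b : (b < a)%O ->
    lo b <= (orbit a).1 <= hi b /\ lo b <= (orbit a).2 <= hi b.
  move=> ba; rewrite oa /=.
  by split; apply/andP; split; (apply: limr_ge || apply: limr_le) => //;
    apply: (near_below ba) => c bc ca;
    have [_ _ _ /(_ b bc)[/andP[? ?] /andP[? ?]]] := Pa c ca.
have [I1 I2 _ _] := Pa b0 b0a.
(* [I] need not be closed: the limits stay in it because they lie between two of
   its points. *)
have Ilo : I (lo b0) by rewrite minEle; case: ifP.
have Ihi : I (hi b0) by rewrite maxEle; case: ifP.
have [bd1 bd2] := bounds b0 b0a.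
split=> //; [exact: (hI Ilo Ihi) | exact: (hI Ilo Ihi) |].
move=> b; rewrite le_eqVlt => /predU1P[->|]; last exact: bounds.
by rewrite min_l ?max_r// !lexx le12.
Qed.

Lemma transfinite_seq_nested a : nested_at a.
Proof.
apply: (well_founded_ind wfW nested_at) => {}a IH.
have [a0|a0] := pselect (is_zero a); first exact: nested_zero.
have [[p pa]|aS] := pselect (exists p, is_succ p a).
  exact: nested_succ pa (IH p pa.1).
exact: nested_limit.
Qed.

Lemma transfinite_seq_cvg a : is_limit a ->
  orbit b @[b --> below a] --> orbit a.
Proof.
by move=> la; have [] := nested_cvg la (fun b _ => transfinite_seq_nested b).
Qed.

Lemma width_le b c : (b <= c)%O ->
  `|(orbit c).1 - (orbit c).2| <= `|(orbit b).1 - (orbit b).2|.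
Proof.
move=> bc; have [_ _ _ /(_ b bc)[]] := transfinite_seq_nested c.
move=> /andP[l1 u1] /andP[l2 u2].
have -> : `|(orbit b).1 - (orbit b).2| = hi b - lo b.
  case: (leP (orbit b).1 (orbit b).2) => h.
    by rewrite distrC ger0_norm// subr_ge0.
  by rewrite ger0_norm// subr_ge0 ltW.
by rewrite ler_norml opprB !lerB.
Qed.

(** Off the diagonal the width would strictly decrease all the way up to the
    uncountable [w1]. *)
Lemma transfinite_seq_omega1 w1 :
  (forall x y, I x -> I y -> x != y -> `|M x y - N x y| < `|x - y|) ->
  is_omega1 w1 -> (orbit w1).1 = (orbit w1).2.
Proof.
move=> hlt [unc _]; apply/eqP/negPn/negP => ne; apply: unc.
apply: (countable_predecessors_decreasing wfW
  (f := fun a => `|(orbit a).1 - (orbit a).2|)) => b c bc cw.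
have [s bs sc] := succ_exists wfW bc.
apply: (le_lt_trans (width_le sc)).
rewrite (transfinite_seq_succ wfW M N x y bs) /=.
have [I1 I2 _ _] := transfinite_seq_nested b.
apply: hlt => //; rewrite -subr_eq0 -normr_gt0.
have bw : (b <= w1)%O by rewrite ltW// (lt_le_trans bc).
by rewrite (lt_le_trans _ (width_le bw))// normr_gt0 subr_eq0.
Qed.

Lemma invariant_transfinite_seq K a : Defs.invariant I M N K ->
  continuous_on_square I K -> K (orbit a).1 (orbit a).2 = K x y.
Proof.
move=> Kinv /subspace_continuousP Kc.
apply: (well_founded_ind wfW
  (fun a => K (orbit a).1 (orbit a).2 = K x y)) => {}a IH.
have [a0|a0] := pselect (is_zero a).
  by rewrite transfinite_seq_zero.
have [[p pa]|aS] := pselect (exists p, is_succ p a).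
  have [I1 I2 _ _] := transfinite_seq_nested p.
  rewrite (transfinite_seq_succ wfW M N x y pa) /= -Kinv//.
  exact: IH pa.1.
have FF := below_filter a0.
have [I1 I2 _ _] := transfinite_seq_nested a.
have orbit_within :
    orbit b @[b --> below a] --> within (I `*` I) (nbhs (orbit a)).
  move=> A /(transfinite_seq_cvg (conj a0 aS)).
  apply: (@filterS _ _ FF) => b; apply.
  by have [] := transfinite_seq_nested b.
have Ka := cvg_comp _ _ orbit_within (Kc (orbit a) (conj I1 I2)).
have Kxy : (fun z => K z.1 z.2) (orbit b) @[b --> below a] --> K x y.
  apply: cvg_near_cst; have [b0 b0a _] := limit_nonzero_below wfW (conj a0 aS).
  by apply: (near_below b0a) => b _ ba; rewrite IH.
exact: (cvg_unique _ Ka Kxy).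
Qed.

End Orbit.

(** * Continuous invariant means *)

Unset Implicit Arguments.
Set Strict Implicit.

Theorem theorem1 (R : realType) (d : Order.disp_t) (W : orderType d)
    (wfW : wellfounded_lt W) (w1 : W) (hw1 : is_omega1 w1)
    (I : set R) (hI : is_interval I) (M N : R -> R -> R)
    (hM : is_mean I M) (hN : is_mean I N)
    (hMN : forall x y, I x -> I y -> M x y <= N x y)
    (hlt : forall x y, I x -> I y -> x != y ->
       `|M x y - N x y| < `|x - y|) :
  (continuous_invariant_mean I M N (transfinite_mean wfW M N w1) /\
   forall K : R -> R -> R, continuous_invariant_mean I M N K ->
     eq_on_square I K (transfinite_mean wfW M N w1)) \/
  ~ (exists K : R -> R -> R, continuous_invariant_mean I M N K).
Proof.
have uniq_mean K : continuous_invariant_mean I M N K ->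
    eq_on_square I K (transfinite_mean wfW M N w1).
  move=> [Kmean Kinv Kc] x y Ix Iy.
  have [I1 _ _ _] := transfinite_seq_nested wfW hI hM hN hMN Ix Iy w1.
  rewrite -(invariant_transfinite_seq wfW hI hM hN hMN Ix Iy w1 Kinv Kc).
  rewrite -(transfinite_seq_omega1 wfW hI hM hN hMN Ix Iy hlt hw1).
  have [_] := Kmean _ _ I1 I1; rewrite minxx maxxx => /le_anti <-.
  by [].
have [[K KP]|] := pselect (exists K, continuous_invariant_mean I M N K);
  last by right.
left; split=> //; have KT := uniq_mean K KP; have [Kmean Kinv Kc] := KP.
split.
- by move=> x y Ix Iy; rewrite -KT//; exact: Kmean.
- move=> x y Ix Iy; have [IM _] := hM _ _ Ix Iy; have [IN _] := hN _ _ Ix Iy.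
  by rewrite -!KT//; exact: Kinv.
- apply: subspace_eq_continuous Kc => z; rewrite inE => -[I1 I2].
  exact: KT.
Qed.
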